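(* Let $d=39028039587479$, let $\varepsilon>1$ be the fundamental unit of the ring of integers $\mathbb{Z}[\sqrt{d}]$ of $\mathbb{Q}(\sqrt{d})$, and let $x,y\in\mathbb{N}_0$ be the unique nonnegative integers with $\varepsilon=x+y\sqrt{d}$. Then $d$ is a prime number, $d\equiv 3\mod 4$ and $d\mid y$.
   Context: For a squarefree integer $d\geq 2$ with $d\equiv 2,3\mod 4$, the ring of integers of $\mathbb{Q}(\sqrt{d})$ is $\mathbb{Z}[\sqrt{d}]$. Its fundamental unit is the unique unit $\varepsilon>1$ such that $\{\pm\varepsilon^k:k\in\mathbb{Z}\}$ is the unit group of $\mathbb{Z}[\sqrt{d}]$. $\mathbb{N}_0$ denotes the set of nonnegative integers. *)

(* Defs.v *)
From Stdlib Require Export ZArith Znumtheory Reals.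

Open Scope R_scope.

(** [Z[sqrt d]], as a subset of the real numbers. *)
Definition in_Zsqrt (d : Z) (u : R) : Prop :=
  exists a b : Z, u = IZR a + IZR b * sqrt (IZR d).

Definition is_unit_Zsqrt (d : Z) (u : R) : Prop :=
  in_Zsqrt d u /\ exists v : R, in_Zsqrt d v /\ u * v = 1.

(** For squarefree [d >= 2] with [d = 2, 3] modulo [4], [Z[sqrt d]] is the ring
    of integers of [Q(sqrt d)], and this is its fundamental unit. *)
Definition is_fundamental_unit (d : Z) (eps : R) : Prop :=
  is_unit_Zsqrt d eps /\ 1 < eps /\
  forall u : R, is_unit_Zsqrt d u <->
    exists k : Z, u = powerRZ eps k \/ u = - powerRZ eps k.

(* Main.v *)
(** A unit [eta > 1] of [Z[sqrt d]] is a power [eps ^ k], [k > 0], of the fundamental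
    unit [eps = x + y sqrt d], and the irrational part of [eps ^ k] is
    [k x ^ (k - 1) y] modulo [d]. As [d] is prime and [x] is prime to [d], it suffices
    to find one unit [eta <> 1, -1], of size less than [2 ^ d], whose irrational part
    is divisible by [d]. Such a unit is too large to be written down conveniently,
    but it has a compact representation: starting from a convergent of [sqrt d], 17
    steps [alpha -> alpha ^ 2 (a + b sqrt d) / m] along the principal cycle of
    reduced ideals lead to a unit, and the residues needed to check that every
    division by [m] is exact and that [d] divides the final irrational part can be
    followed modulo the product of the remaining [m] and [2 d].

    Primality of [d] is Pocklington's criterion with the prime factors 3617 and
    4021 of [d - 1], whose product exceeds [sqrt d]. *)

Require Import Defs.
From Stdlib Require Import ZArith Znumtheory Zpow_facts Reals Lia Lra List.
From mathcomp Require ssreflect ssrbool eqtype ssrnat div prime binomial.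

Open Scope Z_scope.

(** * Fermat's little theorem, transferred to [Z] *)

Module MathCompTransfer.
Import ssreflect ssrbool eqtype ssrnat div prime binomial.

Lemma prime_of_Zprime (p : nat) :
  Znumtheory.prime (Z.of_nat p) -> prime.prime p = true.
Proof.
move=> pr_p; have p_gt1 := prime_ge_2 _ pr_p.
apply/primeP; split; first by apply/ltP; lia.
move=> k /dvdnP [j def_p]; apply/orP.
have k_dvd : (Z.of_nat k | Z.of_nat p).
  by exists (Z.of_nat j); rewrite def_p -multE Nat2Z.inj_mul.
by case: (prime_divisors _ pr_p _ k_dvd) => [|[|[|]]] ?;
  [lia | left; apply/eqP; lia | right; apply/eqP; lia | lia].
Qed.

Lemma expn_pow (a n : nat) : expn a n = Nat.pow a n.
Proof. by elim: n => //= n IHn; rewrite expnS IHn. Qed.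

Lemma fermat_dvd (p a : nat) :
  Znumtheory.prime (Z.of_nat p) ->
  (Z.of_nat p | Z.of_nat a ^ Z.of_nat p - Z.of_nat a).
Proof.
move=> pr_p; have p_gt1 := prime_ge_2 _ pr_p.
have /eqP := fermat_little a (prime_of_Zprime _ pr_p).
(* Subtraction on [nat] truncates, so the congruence is read as a divisibility only for
   [a <= a ^ p]; the other case is contradictory. *)
case: (leqP a (expn a p)) => [le_a | ].
  rewrite eqn_mod_dvd // => /dvdnP [j]; rewrite -minusE -multE => def_j.
  exists (Z.of_nat j); rewrite -Nat2Z.inj_mul -def_j Nat2Z.inj_sub;
    last by apply/leP.
  by rewrite expn_pow Nat2Z.inj_pow.
move=> /ltP; rewrite expn_pow => lt_a.
have := Nat.pow_le_mono_r a 1 p; rewrite Nat.pow_1_r.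
case: a lt_a => [|a] lt_a h; first by lia.
by have := h ltac:(lia) ltac:(lia); lia.
Qed.

End MathCompTransfer.

Lemma fermat_Z (p a : Z) :
  prime p -> 0 <= a -> ~ (p | a) -> (p | a ^ (p - 1) - 1).
Proof.
  intros pr_p Ha Hpa.
  pose proof (prime_ge_2 _ pr_p) as Hp.
  pose proof (MathCompTransfer.fermat_dvd (Z.to_nat p) (Z.to_nat a)) as H.
  rewrite !Z2Nat.id in H by lia. specialize (H pr_p).
  replace (a ^ p - a) with (a * (a ^ (p - 1) - 1)) in H.
  - apply prime_mult in H; tauto.
  - replace p with (Z.succ (p - 1)) at 2 by lia.
    rewrite Z.pow_succ_r by lia. ring.
Qed.

(** * Pocklington's criterion and the primality of [d] *)

Lemma divide_sub_mod (n a b : Z) : 0 < n -> (n | a - b) <-> a mod n = b mod n.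
Proof.
  intros Hn; split; intros H.
  - destruct H as [k Hk]. replace a with (b + k * n) by lia.
    apply Z.mod_add; lia.
  - exists (a / n - b / n).
    pose proof (Z.div_mod a n); pose proof (Z.div_mod b n); nia.
Qed.

Lemma pow_congr_1 (p a n : Z) : 0 < p -> 0 <= n -> (p | a - 1) -> (p | a ^ n - 1).
Proof.
  intros Hp Hn H. apply divide_sub_mod in H; trivial. apply divide_sub_mod; trivial.
  rewrite Zpower_mod, H, <- Zpower_mod by lia. now rewrite Z.pow_1_l.
Qed.

(* Otherwise [q] is invertible modulo [p - 1], and [a ^ m] is a power of
   [a ^ (q * m) = 1] up to a power of [a ^ (p - 1) = 1]. *)
Lemma prime_divide_pred (p q m a : Z) :
  prime p -> prime q -> 0 <= m -> 0 <= a ->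
  (p | a ^ (q * m) - 1) -> ~ (p | a ^ m - 1) -> (q | p - 1).
Proof.
  intros pr_p pr_q Hm Ha Hn Hnm.
  pose proof (prime_ge_2 _ pr_p) as Hp; pose proof (prime_ge_2 _ pr_q) as Hq.
  destruct (Zdivide_dec q (p - 1)) as [|Hnd]; trivial. exfalso; apply Hnm.
  assert (Hm0 : m <> 0).
  { intros ->. apply Hnm. rewrite Z.pow_0_r. apply Z.divide_0_r. }
  assert (Hpa : ~ (p | a)).
  { intros Hd. replace (q * m) with (Z.succ (q * m - 1)) in Hn by lia.
    rewrite Z.pow_succ_r in Hn by nia.
    assert (H1 : (p | 1)).
    { replace 1 with (a * a ^ (q * m - 1) - (a * a ^ (q * m - 1) - 1)) by ring.
      apply Z.divide_sub_r; trivial. now apply Z.divide_mul_l. }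
    apply Z.divide_1_r in H1; lia. }
  destruct (rel_prime_bezout q (p - 1)) as [u v Huv].
  { now apply prime_rel_prime. }
  (* The Bezout coefficients are shifted by multiples of [p - 1] and [q] to make both exponents
     nonnegative. *)
  assert (exists w k, 0 <= w /\ 0 <= k /\ w * q = k * (p - 1) + 1)
    as (w & k & Hw & Hk & Hwk).
  { exists (u + (Z.abs u + Z.abs v) * (p - 1)), ((Z.abs u + Z.abs v) * q - v).
    repeat split; nia. }
  pose proof (fermat_Z p a pr_p Ha Hpa) as HF.
  apply pow_congr_1 with (n := k * m) in HF; try nia.
  apply pow_congr_1 with (n := w) in Hn; try lia.
  rewrite <- Z.pow_mul_r in HF, Hn by nia.
  replace (q * m * w) with ((p - 1) * (k * m) + m) in Hn by nia.
  rewrite Z.pow_add_r in Hn by nia.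
  set (t := a ^ ((p - 1) * (k * m))) in *.
  replace (a ^ m - 1) with (t * a ^ m - 1 - a ^ m * (t - 1)) by ring.
  apply Z.divide_sub_r; trivial. now apply Z.divide_mul_r.
Qed.

Lemma exists_prime_divisor (n : Z) : 1 < n -> exists p, prime p /\ (p | n).
Proof.
  intros Hn. assert (H0 : 0 <= n) by lia. revert Hn. pattern n.
  apply Z_lt_induction; trivial. clear n H0. intros n IH Hn.
  destruct (prime_dec n) as [|Hnp].
  - exists n; split; trivial. apply Z.divide_refl.
  - apply not_prime_divide in Hnp as (k & Hk & Hkn); trivial.
    destruct (IH k) as (p & pr_p & Hp); try lia.
    exists p; split; trivial. now apply Z.divide_trans with k.
Qed.

(** If [n = j * k] properly, primes [p | k] and [q | j] satisfy [p * q <= n], so the smaller of them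
    has square at most [n]. *)
Lemma prime_of_large_prime_divisors (n : Z) :
  1 < n -> (forall p, prime p -> (p | n) -> n < p * p) -> prime n.
Proof.
  intros Hn H. destruct (prime_dec n) as [|Hnp]; trivial. exfalso.
  apply not_prime_divide in Hnp as (k & Hk & Hkn); trivial.
  destruct Hkn as [j Hj]. assert (Hj1 : 1 < j) by (apply (Z.mul_lt_mono_pos_r k); lia).
  destruct (exists_prime_divisor k) as (p & pr_p & Hp); [lia|].
  destruct (exists_prime_divisor j) as (q & pr_q & Hq); [lia|].
  assert (Hp' : n < p * p).
  { apply H; trivial. subst n. now apply Z.divide_mul_r. }
  assert (Hq' : n < q * q).
  { apply H; trivial. subst n. now apply Z.divide_mul_l. }
  apply prime_ge_2 in pr_p, pr_q.
  apply Z.divide_pos_le in Hp, Hq; try lia.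
  assert (q * p <= j * k) by (apply Z.mul_le_mono_nonneg; lia).
  destruct (Z.le_gt_cases p q); nia.
Qed.

Definition no_small_divisor (n : Z) : bool :=
  forallb (fun k => negb (n mod Z.of_nat k =? 0)) (seq 2 (Z.to_nat n - 2)).

Lemma prime_of_no_small_divisor (n : Z) :
  1 < n -> no_small_divisor n = true -> prime n.
Proof.
  intros Hn H. apply prime_alt; split; trivial. intros k Hk Hkn.
  unfold no_small_divisor in H. rewrite forallb_forall in H.
  specialize (H (Z.to_nat k)). rewrite Z2Nat.id in H by lia.
  assert (Hin : In (Z.to_nat k) (seq 2 (Z.to_nat n - 2))) by (apply in_seq; lia).
  apply H in Hin. apply Z.mod_divide in Hkn; [|lia]. now rewrite Hkn in Hin.
Qed.

(** The gcd condition keeps [p] from dividing [a ^ ((n - 1) / q) - 1], while [p] divides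
    [a ^ (n - 1) - 1]. *)
Lemma pocklington_divide_pred (n a p q : Z) :
  1 < n -> 0 <= a -> prime p -> (p | n) -> prime q -> (n - 1) mod q = 0 ->
  Zpow_mod a (n - 1) n = 1 ->
  Z.gcd (Zpow_mod a ((n - 1) / q) n - 1) n = 1 -> (q | p - 1).
Proof.
  intros Hn Ha pr_p Hp pr_q Hq H1 Hg.
  pose proof (prime_ge_2 _ pr_p) as Hp2; pose proof (prime_ge_2 _ pr_q) as Hq2.
  pose proof (Z.div_mod (n - 1) q) as HE.
  set (m := (n - 1) / q) in *.
  assert (Hm : 0 <= m) by (apply Z.div_pos; lia).
  rewrite Zpow_mod_correct in H1, Hg by lia.
  apply prime_divide_pred with m a; trivial.
  - apply Z.divide_trans with n; trivial. apply divide_sub_mod; [lia|].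
    replace (q * m) with (n - 1) by lia. rewrite H1.
    symmetry. now apply Z.mod_1_l.
  - intros H. assert (Hp1 : (p | 1)); [|apply Z.divide_1_r in Hp1; lia].
    rewrite <- Hg. apply Z.gcd_greatest; trivial.
    replace (a ^ m mod n - 1) with (a ^ m - 1 - n * (a ^ m / n)).
    + apply Z.divide_sub_r; trivial. now apply Z.divide_mul_l.
    + pose proof (Z.div_mod (a ^ m) n); lia.
Qed.

Lemma prime_39028039587479 : prime 39028039587479.
Proof.
  apply prime_of_large_prime_divisors; [reflexivity|]. intros p pr_p Hp.
  pose proof (prime_ge_2 _ pr_p) as Hp2.
  assert (pr1 : prime 3617) by
    (apply prime_of_no_small_divisor; [lia | vm_compute; reflexivity]).
  assert (pr2 : prime 4021) by
    (apply prime_of_no_small_divisor; [lia | vm_compute; reflexivity]).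
  assert (H1 : (3617 | p - 1)) by
    (apply (pocklington_divide_pred 39028039587479 2); trivial; try lia;
     vm_compute; reflexivity).
  assert (H2 : (4021 | p - 1)) by
    (apply (pocklington_divide_pred 39028039587479 2); trivial; try lia;
     vm_compute; reflexivity).
  assert (H : (3617 * 4021 | p - 1)).
  { destruct H1 as [j Hj]. rewrite Hj in H2 |- *.
    rewrite Z.mul_comm in H2. apply Gauss in H2 as [i ->].
    - exists i. ring.
    - apply rel_prime_sym, Zgcd_1_rel_prime. reflexivity. }
  apply Z.divide_pos_le in H; nia.
Qed.

(** * A large unit in compact representation *)

(** Bounds both coordinates of [(x + y sqrt d) ^ 2 (a + b sqrt d)]: the rational one with [b * d]
    for [b], the irrational one with [a] and [b] exchanged. *)
Lemma abs_quadratic_le (d E x y a b : Z) :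
  0 <= d -> Z.abs x <= E -> Z.abs y <= E ->
  Z.abs ((x * x + d * (y * y)) * a + 2 * (x * y) * b)
    <= E * E * ((1 + d) * Z.abs a + 2 * Z.abs b).
Proof.
  intros Hd Hx Hy.
  assert (Hxx : Z.abs x * Z.abs x <= E * E) by (apply Z.mul_le_mono_nonneg; lia).
  assert (Hyy : Z.abs y * Z.abs y <= E * E) by (apply Z.mul_le_mono_nonneg; lia).
  assert (Hxy : Z.abs x * Z.abs y <= E * E) by (apply Z.mul_le_mono_nonneg; lia).
  assert (Hs : Z.abs (x * x + d * (y * y)) <= E * E * (1 + d)).
  { rewrite Z.abs_eq; [|apply Z.add_nonneg_nonneg; [|apply Z.mul_nonneg_nonneg];
      trivial; apply Z.square_nonneg].
    rewrite <- (Z.abs_square x), <- (Z.abs_square y).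
    assert (d * (Z.abs y * Z.abs y) <= d * (E * E))
      by (now apply Z.mul_le_mono_nonneg_l).
    lia. }
  eapply Z.le_trans; [apply Z.abs_triangle|].
  rewrite !(Z.abs_mul _ a), !(Z.abs_mul _ b), (Z.abs_mul 2), (Z.abs_mul x).
  rewrite (Z.abs_eq 2) by lia.
  assert (Z.abs (x * x + d * (y * y)) * Z.abs a <= E * E * (1 + d) * Z.abs a)
    by (apply Z.mul_le_mono_nonneg_r; lia).
  assert (Z.abs x * Z.abs y * Z.abs b <= E * E * Z.abs b)
    by (apply Z.mul_le_mono_nonneg_r; lia).
  lia.
Qed.

(* In the application [x] and [y] have up to about two million digits, so only
   their size, their residues [r], [s] modulo [M] and the norm [N] of
   [x + y sqrt d] are tracked. *)
Definition represents (d e N M r s : Z) : Prop :=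
  exists x y : Z, x * x - d * (y * y) = N /\ (M | x - r) /\ (M | y - s) /\
    Z.abs x <= 2 ^ e /\ Z.abs y <= 2 ^ e.

(** Residues modulo [m * M] decide divisibility by [m] and fix the quotients modulo [M]; the norm is
    multiplicative. *)
Lemma represents_step (d e c N N' m M r s a b : Z) :
  0 <= d -> 0 <= e -> 0 <= c -> 0 < m ->
  represents d e N (m * M) r s ->
  (m | (r * r + d * (s * s)) * a + 2 * (r * s) * b * d) ->
  (m | (r * r + d * (s * s)) * b + 2 * (r * s) * a) ->
  N * N * (a * a - d * (b * b)) = m * m * N' ->
  (1 + d) * Z.abs a + 2 * (Z.abs b * d) + (1 + d) * Z.abs b + 2 * Z.abs a
    <= 2 ^ c ->
  represents d (2 * e + c) N' M
    (((r * r + d * (s * s)) * a + 2 * (r * s) * b * d) / m)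
    (((r * r + d * (s * s)) * b + 2 * (r * s) * a) / m).
Proof.
  intros Hd He Hc Hm (x & y & HN & Hx & Hy & Bx & By) HX HY HN' Hab.
  destruct Hx as [i Hi], Hy as [j Hj].
  destruct HX as [X HX], HY as [Y HY]. rewrite HX, HY, !Z.div_mul by lia.
  assert (Ex : x = r + i * m * M) by lia.
  assert (Ey : y = s + j * m * M) by lia. clear Hi Hj.
  (* Here [x * x + d * (y * y) = r * r + d * (s * s) + m * M * t] and
     [x * y = r * s + m * M * w]. *)
  set (t := i * (2 * r + i * m * M) + d * (j * (2 * s + j * m * M))).
  set (w := i * s + j * r + i * j * m * M).
  exists (X + M * (t * a + 2 * w * b * d)), (Y + M * (t * b + 2 * w * a)).
  set (x' := X + _). set (y' := Y + _).
  assert (Hx' : x' * m = (x * x + d * (y * y)) * a + 2 * (x * y) * b * d).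
  { unfold x'. rewrite Z.mul_add_distr_r, <- HX. subst x y; unfold t, w; ring. }
  assert (Hy' : y' * m = (x * x + d * (y * y)) * b + 2 * (x * y) * a).
  { unfold y'. rewrite Z.mul_add_distr_r, <- HY. subst x y; unfold t, w; ring. }
  assert (HB : 2 ^ (2 * e + c) = 2 ^ e * 2 ^ e * 2 ^ c).
  { rewrite Z.pow_add_r by lia. replace (2 * e) with (e + e) by lia.
    rewrite Z.pow_add_r by lia. ring. }
  assert (HE : 0 <= 2 ^ e * 2 ^ e) by (apply Z.mul_nonneg_nonneg; lia).
  assert (Hle : forall z, Z.abs z <= Z.abs (z * m)).
  { intros z. rewrite Z.abs_mul. rewrite <- (Z.mul_1_r (Z.abs z)) at 1.
    apply Z.mul_le_mono_nonneg_l; lia. }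
  assert (Dx : x' = X + M * (t * a + 2 * w * b * d)) by reflexivity.
  assert (Dy : y' = Y + M * (t * b + 2 * w * a)) by reflexivity.
  clearbody t w x' y'.
  repeat split.
  - assert (Hm2 : m * m <> 0) by nia. apply (Z.mul_reg_l _ _ (m * m)); trivial.
    rewrite <- HN', <- HN.
    replace (m * m * (x' * x' - d * (y' * y')))
      with (x' * m * (x' * m) - d * (y' * m * (y' * m))) by ring.
    rewrite Hx', Hy'. ring.
  - exists (t * a + 2 * w * b * d). rewrite Dx; ring.
  - exists (t * b + 2 * w * a). rewrite Dy; ring.
  - rewrite HB. eapply Z.le_trans; [apply Hle|]. rewrite Hx'.
    replace (2 * (x * y) * b * d) with (2 * (x * y) * (b * d)) by ring.
    eapply Z.le_trans; [now apply abs_quadratic_le with (E := 2 ^ e)|].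
    apply Z.mul_le_mono_nonneg_l; trivial.
    rewrite Z.abs_mul, (Z.abs_eq d) by lia. lia.
  - rewrite HB. eapply Z.le_trans; [apply Hle|]. rewrite Hy'.
    eapply Z.le_trans; [now apply abs_quadratic_le with (E := 2 ^ e)|].
    apply Z.mul_le_mono_nonneg_l; trivial. lia.
Qed.

Lemma represents_mod (d e N M r s : Z) :
  0 < M -> represents d e N M r s -> represents d e N M (r mod M) (s mod M).
Proof.
  intros HM (x & y & HN & Hx & Hy & B).
  exists x, y; repeat split; try tauto.
  - destruct Hx as [k Hk]. exists (k + r / M). pose proof (Z.div_mod r M); lia.
  - destruct Hy as [k Hk]. exists (k + s / M). pose proof (Z.div_mod s M); lia.
Qed.

Record state := State { exponent : Z; norm : Z; modulus : Z; re : Z; im : Z }.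

Definition represented (d : Z) (S : state) : Prop :=
  0 <= exponent S /\
  represents d (exponent S) (norm S) (modulus S) (re S) (im S).

(* Replaces [alpha = x + y sqrt d] by [alpha ^ 2 (a + b sqrt d) / m]. The exact
   division by [m] uses up a factor [m] of the modulus. *)
Definition square_mul_div (d c : Z) (S : state) (g : Z * Z * Z) : option state :=
  let '(a, b, m) := g in
  let '(State e N mM r s) := S in
  let M := mM / m in
  let u := r * r + d * (s * s) in
  let v := 2 * (r * s) in
  let X := u * a + v * b * d in
  let Y := u * b + v * a in
  let n := N * N * (a * a - d * (b * b)) in
  if ((0 <? m) && (0 <? M) && (mM mod m =? 0)
     && (X mod m =? 0) && (Y mod m =? 0) && (n mod (m * m) =? 0)
     && ((1 + d) * Z.abs a + 2 * (Z.abs b * d) + (1 + d) * Z.abs b + 2 * Z.abs a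
           <=? 2 ^ c))%bool
  then Some (State (2 * e + c) (n / (m * m)) M (X / m mod M) (Y / m mod M))
  else None.

Lemma square_mul_div_correct (d c : Z) (S S' : state) (g : Z * Z * Z) :
  0 <= d -> 0 <= c -> represented d S -> square_mul_div d c S g = Some S' ->
  represented d S'.
Proof.
  destruct g as [[a b] m], S as [e N mM r s]. intros Hd Hc [He HS].
  cbn [exponent norm modulus re im] in *.
  unfold square_mul_div. cbv zeta.
  destruct (_ && _)%bool eqn:E; [|discriminate].
  rewrite !Bool.andb_true_iff in E.
  destruct E as [[[[[[Hm HM] HmM] HX] HY] Hn] Hb].
  apply Z.ltb_lt in Hm, HM. apply Z.leb_le in Hb. apply Z.eqb_eq in HmM, HX, HY, Hn.
  intros HS'. match type of HS' with Some ?T = _ =>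
    replace S' with T by congruence end.
  split; cbn [exponent norm modulus re im]; [lia|].
  apply Z.div_exact in HmM, Hn; try nia.
  apply Z.mod_divide in HX, HY; try lia.
  apply represents_mod; trivial.
  apply represents_step with (N := N); trivial.
  now rewrite <- HmM.
Qed.

Fixpoint run (d c : Z) (S : state) (l : list (Z * Z * Z)) : option state :=
  match l with
  | nil => Some S
  | g :: l => match square_mul_div d c S g with
              | Some S' => run d c S' l
              | None => None
              end
  end.

Lemma run_correct (d c : Z) (l : list (Z * Z * Z)) (S S' : state) :
  0 <= d -> 0 <= c -> represented d S -> run d c S l = Some S' ->
  represented d S'.
Proof.
  intros Hd Hc. revert S. induction l as [|g l IH]; cbn [run]; intros S HS.
  - now intros [= <-].
  - destruct (square_mul_div d c S g) as [S1|] eqn:E; [|discriminate].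
    apply IH. now apply (square_mul_div_correct d c S S1 g).
Qed.

(* Each entry [(a, b, m)] comes from the continued fraction expansion of the
   squared ideal: [(a + b sqrt d) / m] moves it to a reduced principal ideal at
   distance close to [R / 2 ^ j], where [R] is the regulator
   (about [4328927.67]) and [j] is the number of remaining entries. *)
Definition factors : list (Z * Z * Z) :=
  (19565970585526, 3131937, 144365391496225) ::
  (3937991717, 630, 16085595241) ::
  (939516709127, 150389, 1190344278841) ::
  (5816202642, 931, 5455494490) ::
  (798066016769, 127747, 178594986025) ::
  (5553404159487, 888937, 9139343014082) ::
  (981696114119, 157141, 2386898374802) ::
  (2850984455501, 456359, 4525951307522) ::
  (1678728947177, 268715, 2636538178562) ::
  (5568304289727, 891322, 4386822708578) ::
  (2874616365881, 460141, 5040756896569) ::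
  (178783587695, 28618, 43815926138) ::
  (2813413399, 447, 312468702121) ::
  (1109054414271, 177527, 70271256050) ::
  (4451218162991, 712508, 67867890662450) ::
  (3737438555022, 598255, 4254124877809) ::
  (39028029849780, 6247241, 94822781814601) :: nil.

Lemma large_unit_exists :
  exists e x y : Z, 0 <= e < 39028039587479 - 100 /\
    x * x - 39028039587479 * (y * y) = 1 /\ y <> 0 /\
    (39028039587479 | y) /\ Z.abs x <= 2 ^ e /\ Z.abs y <= 2 ^ e.
Proof.
  set (d := 39028039587479).
  (* After all divisions the modulus [2 * d] is left; the factor 2 serves to show that the
     irrational part is nonzero. *)
  set (M := fold_right (fun g M => snd g * M) (2 * d) factors).
  (* The starting element is the convergent of [sqrt d] whose logarithm is
     closest to [R / 2 ^ 17]. *)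
  set (S := State 48 (-12015215) M 212162429613889 33960972).
  assert (HS : represented d S).
  { split; [discriminate|].
    exists 212162429613889, 33960972. repeat split.
    - exists 0. reflexivity.
    - exists 0. reflexivity.
    - discriminate.
    - discriminate. }
  (* Each step doubles the exponent and adds 100, whence [19398556 = 48 * 2 ^ 17 + 100 * (2 ^ 17 -
     1)]. *)
  assert (E : run d 100 S factors
              = Some (State 19398556 1 (2 * d) (d + 1) d))
    by (vm_compute; reflexivity).
  destruct (run_correct d 100 factors S _ ltac:(discriminate) ltac:(discriminate)
              HS E) as [_ (x & y & HN & Hx & [k Hk] & Bx & By)].
  cbn [exponent norm modulus re im] in *.
  refine (ex_intro _ 19398556 (ex_intro _ x (ex_intro _ y _))).
  refine (conj (conj _ _) (conj HN (conj _ (conj _ (conj Bx By))))).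
  - discriminate.
  - reflexivity.
  (* Being [d] modulo [2 * d], [y] is an odd multiple of [d]. *)
  - clear - Hk. lia.
  - exists (2 * k + 1). clear - Hk. lia.
Qed.

(** * Coordinates, powers and units in [Z[sqrt d]] *)

(** Infinite descent on [Z.abs b]: [d] divides [a], hence also [b], and both can be divided by
    [d]. *)
Lemma prime_mul_square_eq (d a b : Z) : prime d -> a * a = d * (b * b) -> b = 0.
Proof.
  intros pr_d. pose proof (prime_ge_2 _ pr_d) as Hd.
  remember (Z.abs b) as n eqn:Hn.
  assert (H0 : 0 <= n) by lia. revert a b Hn. pattern n.
  apply Z_lt_induction; trivial. clear n H0. intros n IH a b Hn H.
  assert (Ha : (d | a)).
  { assert (Hd2 : (d | a * a)) by (rewrite H; apply Z.divide_factor_l).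
    apply prime_mult in Hd2; tauto. }
  destruct Ha as [a' ->].
  assert (H' : b * b = d * (a' * a')) by (apply (Z.mul_reg_l _ _ d); lia).
  assert (Hb : (d | b)).
  { assert (Hd2 : (d | b * b)) by (rewrite H'; apply Z.divide_factor_l).
    apply prime_mult in Hd2; tauto. }
  destruct Hb as [b' ->].
  destruct (Z.eq_dec b' 0) as [->|Hb']; trivial.
  rewrite (IH (Z.abs b')) with (a := a') (b := b'); trivial.
  - rewrite Z.abs_mul in Hn. nia.
  - apply (Z.mul_reg_l _ _ d); lia.
Qed.

Lemma Zsqrt_eq (d a b a' b' : Z) : prime d ->
  (IZR a + IZR b * sqrt (IZR d) = IZR a' + IZR b' * sqrt (IZR d))%R ->
  a = a' /\ b = b'.
Proof.
  intros pr_d H. pose proof (prime_ge_2 _ pr_d) as Hd.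
  assert (Hs : (sqrt (IZR d) * sqrt (IZR d) = IZR d)%R)
    by (apply sqrt_sqrt, IZR_le; lia).
  assert (Hb : b' - b = 0).
  { apply (prime_mul_square_eq d (a - a')); trivial. apply eq_IZR.
    rewrite !mult_IZR, !minus_IZR, <- Hs.
    replace (IZR a - IZR a')%R with ((IZR b' - IZR b) * sqrt (IZR d))%R by lra.
    ring. }
  assert (b' = b) as -> by lia. split; trivial. apply eq_IZR. lra.
Qed.

(** Modulo [d] only the first two binomial terms matter. The factor [x] on [B] avoids the exponent
    [n - 1], which is negative for [n = 0]. *)
Lemma pow_Zsqrt (d x y : Z) (n : nat) : 0 <= d ->
  exists A B : Z,
    ((IZR x + IZR y * sqrt (IZR d)) ^ n = IZR A + IZR B * sqrt (IZR d))%R /\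
    (d | A - x ^ Z.of_nat n) /\
    (d | B * x - Z.of_nat n * x ^ Z.of_nat n * y).
Proof.
  intros Hd.
  assert (Hs : (sqrt (IZR d) * sqrt (IZR d) = IZR d)%R)
    by now apply sqrt_sqrt, IZR_le.
  set (sd := sqrt (IZR d)) in *. clearbody sd.
  induction n as [|n (A & B & HAB & HA & HB)].
  - exists 1, 0. repeat split; [cbn; lra | exists 0; reflexivity..].
  - exists (x * A + d * (y * B)), (x * B + y * A). repeat split.
    + rewrite <- tech_pow_Rmult, HAB, !plus_IZR, !mult_IZR, <- Hs. ring.
    + rewrite Nat2Z.inj_succ, Z.pow_succ_r by lia.
      destruct HA as [k Hk]. exists (x * k + y * B). lia.
    + rewrite Nat2Z.inj_succ, Z.pow_succ_r by lia.
      destruct HA as [k Hk], HB as [l Hl]. exists (x * l + y * x * k).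
      replace A with (x ^ Z.of_nat n + k * d) by lia.
      replace (Z.succ (Z.of_nat n)) with (Z.of_nat n + 1) by lia.
      assert (HBx : B * x = l * d + Z.of_nat n * x ^ Z.of_nat n * y) by lia.
      replace ((x * B + y * (x ^ Z.of_nat n + k * d)) * x)
        with (x * (B * x) + y * (x ^ Z.of_nat n + k * d) * x) by ring.
      rewrite HBx. ring.
Qed.

(** The conjugate is the inverse. *)
Lemma is_unit_Zsqrt_of_norm_1 (d a b : Z) : 0 <= d -> a * a - d * (b * b) = 1 ->
  is_unit_Zsqrt d (IZR a + IZR b * sqrt (IZR d))%R.
Proof.
  intros Hd H. split; [now exists a, b|].
  exists (IZR a + IZR (- b) * sqrt (IZR d))%R. split; [now exists a, (- b)|].
  assert (Hs : (sqrt (IZR d) * sqrt (IZR d) = IZR d)%R)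
    by now apply sqrt_sqrt, IZR_le.
  set (sd := sqrt (IZR d)) in *. clearbody sd.
  rewrite <- H, opp_IZR, minus_IZR, !mult_IZR, <- Hs. ring.
Qed.

(** * From the large unit to the fundamental unit *)

Lemma IZR_pow2 (e : Z) : 0 <= e -> IZR (2 ^ e) = (2 ^ Z.to_nat e)%R.
Proof. intros He. rewrite <- (Z2Nat.id e) at 1 by lia. now rewrite pow_IZR. Qed.

(* If [eta = eps ^ k] with [eps = x + y sqrt d], then
   [im eta = k x ^ (k - 1) y] modulo [d], where [x] is prime to [d] and [0 < k < d]
   because [2 ^ k <= eps ^ k]. *)
Lemma divide_fundamental_of_divide_unit (d e X Y : Z) (x y : nat) (eps : R) :
  prime d -> 4 <= d -> d <= 2 ^ 90 -> 0 <= e < d - 100 ->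
  X * X - d * (Y * Y) = 1 -> Y <> 0 -> (d | Y) ->
  Z.abs X <= 2 ^ e -> Z.abs Y <= 2 ^ e ->
  is_fundamental_unit d eps ->
  (eps = INR x + INR y * sqrt (IZR d))%R ->
  (d | Z.of_nat y).
Proof.
  intros pr_d Hd4 Hd90 He HN HY HdY BX BY (Hunit & Hgt1 & Hgen) Heps.
  rewrite !INR_IZR_INZ in Heps.
  destruct (Z.eq_dec (Z.of_nat y) 0) as [Hy0|Hy0];
    [rewrite Hy0; apply Z.divide_0_r|].
  assert (HIX : (0 <= IZR (Z.of_nat x))%R) by (apply IZR_le; lia).
  assert (HIY : (1 <= IZR (Z.of_nat y))%R) by (apply IZR_le; lia).
  set (x' := Z.of_nat x) in *. set (y' := Z.of_nat y) in *. clearbody x' y'.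
  set (sd := sqrt (IZR d)) in *.
  assert (Hs : (sd * sd = IZR d)%R) by (apply sqrt_sqrt, IZR_le; lia).
  assert (Hs0 : (0 <= sd)%R) by apply sqrt_pos.
  assert (HdR : (4 <= IZR d)%R) by (now apply IZR_le).
  assert (Hs2 : (2 <= sd)%R) by nra.
  assert (Heps2 : (2 <= eps)%R) by nra.
  (* The rational part of [eps * v = 1] reads [x' * p + d * (y' * q) = 1]. *)
  assert (Hxd : ~ (d | x')).
  { destruct Hunit as [_ (v & (p & q & Hv) & Huv)].
    rewrite Heps, Hv in Huv. fold sd in Huv.
    assert (H1 : x' * p + d * (y' * q) = 1 /\ x' * q + y' * p = 0).
    { apply (Zsqrt_eq d); trivial. rewrite !plus_IZR, !mult_IZR. fold sd.
      rewrite <- Hs. lra. }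
    destruct H1 as [H1 _]. intros [k Hk].
    assert (H2 : (d | 1)) by (exists (k * p + y' * q); rewrite <- H1, Hk; ring).
    apply Z.divide_1_r in H2; lia. }
  (* Absolute values keep the norm and the divisibility by [d] and give [u > 1], so that [u] is a
     positive power of [eps]. *)
  set (u := (IZR (Z.abs X) + IZR (Z.abs Y) * sd)%R).
  assert (Hu : is_unit_Zsqrt d u).
  { apply is_unit_Zsqrt_of_norm_1; [lia|]. now rewrite !Z.abs_square. }
  assert (HaX : (0 <= IZR (Z.abs X))%R) by (apply IZR_le; lia).
  assert (HaY : (1 <= IZR (Z.abs Y))%R) by (apply IZR_le; lia).
  assert (Hu1 : (1 < u)%R) by (unfold u; nra).
  apply Hgen in Hu as [k Hk].
  assert (Hpos : forall j, (0 < powerRZ eps j)%R)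
    by (intros j; apply powerRZ_lt; lra).
  assert (Hk' : u = powerRZ eps k).
  { destruct Hk as [|Hk]; trivial. specialize (Hpos k). lra. }
  clear Hk. destruct k as [|n|n]; cbn [powerRZ] in Hk'.
  - lra.
  - set (k := Pos.to_nat n) in *.
    assert (Hk0 : (0 < k)%nat) by apply Pos2Nat.is_pos. clearbody k.
    assert (Hkd : Z.of_nat k < d).
    (* Otherwise [2 ^ k <= u <= 2 ^ (e + 91)], using [sqrt d <= d <= 2 ^ 90], against
       [k >= d > e + 100]. *)
    { apply Z.lt_nge. intros Hge.
      assert (Hlow : (2 ^ k <= u)%R) by (rewrite Hk'; apply pow_incr; lra).
      apply IZR_le in BX, BY, Hd90. rewrite IZR_pow2 in BX, BY by lia.
      rewrite IZR_pow2 in Hd90 by lia.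
      assert (Hsle : (sd <= IZR d)%R) by nra.
      set (E := (2 ^ Z.to_nat e)%R) in *.
      assert (HE : (0 < E)%R) by (apply pow_lt; lra).
      set (D := (2 ^ Z.to_nat 90)%R) in *.
      assert (Hup : (u <= E * (2 * D))%R).
      { unfold u. assert (IZR (Z.abs Y) * sd <= E * D)%R
          by (apply Rmult_le_compat; lra).
        nra. }
      assert (HED : (E * (2 * D) = 2 ^ (Z.to_nat e + (1 + Z.to_nat 90)))%R)
        by (rewrite !pow_add, pow_1; reflexivity).
      assert (Hlt : (2 ^ (Z.to_nat e + (1 + Z.to_nat 90)) < 2 ^ k)%R)
        by (apply Rlt_pow; [lra | lia]).
      lra. }
    destruct (pow_Zsqrt d x' y' k) as (A & B & HAB & _ & HB); [lia|].
    fold sd in HAB. rewrite <- Heps, <- Hk' in HAB.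
    apply Zsqrt_eq in HAB as [_ HAB]; trivial.
    assert (HdB : (d | B)) by (rewrite <- HAB; now apply Z.divide_abs_r).
    assert (H : (d | Z.of_nat k * x' ^ Z.of_nat k * y')).
    { replace (Z.of_nat k * x' ^ Z.of_nat k * y')
        with (B * x' - (B * x' - Z.of_nat k * x' ^ Z.of_nat k * y')) by ring.
      apply Z.divide_sub_r; trivial. now apply Z.divide_mul_l. }
    apply prime_mult in H as [H|H]; trivial.
    apply prime_mult in H as [H|H]; trivial; exfalso.
    + apply Z.divide_pos_le in H; lia.
    + apply (prime_rel_prime d pr_d) in Hxd.
      apply (rel_prime_Zpower_r (Z.of_nat k)) in Hxd; [|lia].
      destruct Hxd as [_ _ Hxd].
      specialize (Hxd d (Z.divide_refl d) H). apply Z.divide_1_r in Hxd; lia.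
  (* A negative exponent would give [u <= 1]. *)
  - specialize (Hpos (Z.pos n)). cbn [powerRZ] in Hpos.
    assert (H1 : (1 <= eps ^ Pos.to_nat n)%R) by (apply pow_R1_Rle; lra).
    apply Rinv_le_contravar in H1; lra.
Qed.

Open Scope R_scope.

Theorem mainTheorem1 :
  let d : Z := 39028039587479%Z in
  prime d /\
  (d mod 4 = 3)%Z /\
  forall (eps : R) (x y : nat),
    is_fundamental_unit d eps ->
    eps = INR x + INR y * sqrt (IZR d) ->
    (d | Z.of_nat y)%Z.
Proof.
  split; [exact prime_39028039587479|]. split; [reflexivity|].
  intros eps x y Hunit Heps.
  destruct large_unit_exists as (e & X & Y & He & HN & HY & HdY & BX & BY).
  apply (divide_fundamental_of_divide_unit _ e X Y x y eps); trivial.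
  - exact prime_39028039587479.
  - discriminate.
  - discriminate.
Qed.
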